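(* (a) For every integer $k\geq 2$, every graph $G$ of order $n\geq 7\left\lfloor\dfrac{k^2}{4}\right\rfloor$ with minimum degree $\delta(G)\geq\dfrac{k(k+3)}{2}$ contains $k$ pairwise vertex-disjoint cycles whose lengths are pairwise different. (b) The bound on $\delta(G)$ is best possible: for every $k\geq 2$ and every sufficiently large $n$, there is a graph of order $n$ with minimum degree $\dfrac{k(k+3)}{2}-1$ that does not contain $k$ pairwise vertex-disjoint cycles of pairwise different lengths.
   Context: All graphs are finite and simple. The length of a cycle is its number of vertices. *)

(* Defs.v *)
From mathcomp Require Import all_boot.

Set Implicit Arguments.
Unset Strict Implicit.
Unset Printing Implicit Defensive.

Record sgraph := SGraph {
  vertex :> finType;
  adj : rel vertex;
  adj_sym : symmetric adj;
  adj_irrefl : irreflexive adj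
}.

Definition order_of (G : sgraph) : nat := #|G|.

Definition degree (G : sgraph) (x : G) : nat := #|[set y : G | adj x y]|.

(* Every degree is smaller than #|G|, so the default value #|G| never affects
   the minimum on a nonempty graph; the graph with no vertex gets 0. *)
Definition min_degree (G : sgraph) : nat :=
  \big[minn/#|G|]_(x : G) degree x.

(* A cycle is given by the sequence of its vertices in cyclic order, so its
   length is the size of the sequence. The bound on the size is needed because
   the path library's [cycle] also accepts the empty sequence and, for a
   symmetric relation, a single edge [:: x; y]. *)
Definition is_cycle (G : sgraph) (c : seq G) : bool :=
  [&& 3 <= size c, cycle (@adj G) c & uniq c].

Definition has_disjoint_cycles_of_distinct_lengths (G : sgraph) (k : nat) :
    Prop :=
  exists C : 'I_k -> seq G,
    [/\ forall i, is_cycle (C i),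
        forall i j, i != j -> [disjoint C i & C j]
      & forall i j, i != j -> size (C i) != size (C j)].

(* Main.v *)
Require Import Defs.
From mathcomp Require Import all_boot.
From mathcomp Require Import zify.

(* (a) A vertex x whose d neighbours in a set all lie on a path starting at x
   lies on cycles of d - 1 different lengths. Let p be maximal such that G has
   disjoint cycles of lengths 3, ..., p + 2, and suppose p < k. Among all these
   packings take one leaving a cycle E of length l <= p + 2 with l maximal, let
   C be the cycle of length l of the packing and R the set of remaining
   vertices. Exchanging C and E shows that neither R + C nor R + E contains a
   cycle whose length is in ]l, p + 3], so every vertex of R has at most l/2
   neighbours on C and at most l/2 on E.
   - If p = k - 1, no cycle of R + C or R + E may be longer than l. The end x of
     a longest path of R (ending next to E if possible) has many neighbours on
     that path; a rotation yields another such end x', joined to x by a path so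
     long that it extends C to a longer cycle.
   - If p < k - 1, remove greedily from R a shortest cycle longer than p + 3,
     then a shortest one longer than the previous one, and so on. By the first
     remark a remaining vertex has few neighbours on each of these cycles, and
     at most about l/2 on the first one since lengths in ]l, p + 3] are missing.
     The end of a maximal path which finishes by running around E then has so
     large a degree that it provides the last new length.
   (b) In K_(a, n - a) with a = k(k + 3)/2 - 1, disjoint cycles of distinct
   lengths use at least 2 + 3 + ... + (k + 1) > a vertices of the small side. *)

Set Implicit Arguments.
Unset Strict Implicit.
Unset Printing Implicit Defensive.

(** * Cycles from arcs, chords and paths *)

Definition cyc (G : sgraph) (S : {set G}) (l : nat) : bool :=
  [exists t : l.-tuple G, is_cycle t && all (mem S) t].

Lemma cycP (G : sgraph) (S : {set G}) l :
  reflect (exists c : seq G, [/\ is_cycle c, size c = l & {subset c <= S}])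
          (cyc S l).
Proof.
apply: (iffP existsP) => [[t /andP[ct /allP tS]]|[c [cc cl cS]]].
  by exists t; rewrite size_tuple.
have ct : size c == l by apply/eqP.
by exists (Tuple ct); rewrite /= cc; apply/allP.
Qed.

Lemma cyc_sub (G : sgraph) (S T : {set G}) l : S \subset T -> cyc S l -> cyc T l.
Proof.
move=> /subsetP ST /cycP[c [cc cl cS]]; apply/cycP; exists c; split=> // x /cS.
exact: ST.
Qed.

Lemma cyc_ge3 (G : sgraph) (S : {set G}) l : cyc S l -> 3 <= l.
Proof. by case/cycP=> c [/and3P[? _ _] <- _]. Qed.

(** The new cycle follows the arc [take a c], then the path, and returns; [2 <= a + size q] excludes
    a doubled edge. *)
Lemma arc_cycle (G : sgraph) (c q : seq G) x a :
  cycle (@adj G) c -> uniq (c ++ x :: q) -> path (@adj G) x q ->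
  0 < a <= size c -> 2 <= a + size q ->
  adj (last x q) (nth x c 0) -> adj x (nth x c a.-1) ->
  is_cycle (take a c ++ x :: q).
Proof.
case: c => [|y c]; first by case: a.
case: a => [//|a] /= cc uc pq /= ac aq e1 e2.
have sz : size (take a c) = a by rewrite size_takel //; move: ac => /=; lia.
apply/and3P; split.
- by rewrite /= size_cat sz /=; lia.
- rewrite /= rcons_cat cat_path /= rcons_path pq e1 andbT.
  move: cc; rewrite /= rcons_path => /andP[pc _].
  rewrite -{1}(cat_take_drop a c) cat_path in pc; case/andP: pc => -> _ /=.
  have -> : last y (take a c) = nth x (y :: c) a.
    rewrite -nth_last sz; case: a ac {aq e2 sz} => [|a] ac; first by rewrite take0.
    by rewrite /= nth_take //; apply: set_nth_default; lia.
  by rewrite adj_sym andbT.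
- have H := cat_subseq (take_subseq (y :: c) a.+1) (subseq_refl (x :: q)).
  exact: (subseq_uniq H uc).
Qed.

Lemma chord_cycle (G : sgraph) x (q : seq G) i :
  path (@adj G) x q -> uniq (x :: q) -> 0 < i < size q -> adj x (nth x q i) ->
  is_cycle (x :: take i.+1 q).
Proof.
move=> pq uq /andP[i0 iq] e; apply/and3P; split.
- by rewrite /= size_takel; lia.
- rewrite /= rcons_path; rewrite -{1}(cat_take_drop i.+1 q) cat_path in pq.
  case/andP: pq => -> _ /=.
  by rewrite -nth_last size_takel //= nth_take // adj_sym.
- by apply: (subseq_uniq _ uq); rewrite /= eqxx; apply: take_subseq.
Qed.

Lemma count_nth (T : Type) (x0 : T) (a : pred T) s :
  count a s = count (fun i => a (nth x0 s i)) (iota 0 (size s)).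
Proof. by rewrite -{1}(mkseq_nth x0 s) /mkseq count_map. Qed.

(* Each neighbour of x on the path, except the first one, closes a cycle with
   x, and these cycles have different lengths. *)
Lemma count_path_lengths (G : sgraph) (S : {set G}) (ML : seq nat) x (q : seq G) :
  path (@adj G) x q -> uniq (x :: q) -> {subset x :: q <= S} ->
  (forall l, l <= (size q).+1 -> cyc S l -> l \in ML) ->
  count (adj x) q <= (size ML).+1.
Proof.
case: q => [//|y q] pq uq qS H; rewrite /= -add1n leq_add ?leq_b1 //.
(* The neighbour at index i of the rest of the path closes a cycle on 3 + i vertices: [x], [y] and i
   + 1 further ones. *)
rewrite (count_nth x) -size_filter -(size_map (addn 3)).
apply: uniq_leq_size => [|l /mapP[i]].
  by rewrite map_inj_uniq ?filter_uniq ?iota_uniq //; apply: addnI.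
rewrite mem_filter mem_iota add0n => /andP[e iq] ->.
apply: H => /=; first by move: iq; lia.
apply/cycP; exists (x :: take i.+2 (y :: q)); split.
- by apply: chord_cycle.
- by rewrite /= size_takel; lia.
- move=> z; rewrite inE => /orP[/eqP->|/mem_take zq]; apply: qS.
    by rewrite mem_head.
  by rewrite inE zq orbT.
Qed.

Lemma is_cycle_rot (G : sgraph) n (c : seq G) : is_cycle (rot n c) = is_cycle c.
Proof. by rewrite /is_cycle size_rot rot_cycle rot_uniq. Qed.

(** Cutting [c] at the non-neighbour [z] leaves a path, and [x] can be put in front of its first
    neighbour there. As [z] is dropped, the cycles closed have at most [size c] vertices. *)
Lemma count_cycle_lengths (G : sgraph) (S : {set G}) (ML : seq nat) x z (c : seq G) :
  is_cycle c -> {subset c <= S} -> x \in S -> x \notin c ->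
  z \in c -> ~~ adj x z ->
  (forall l, l <= size c -> cyc S l -> l \in ML) ->
  count (adj x) c <= (size ML).+1.
Proof.
move=> cc cS xS xc zc nxz H.
have [i d E] := rot_to zc.
have := cc; rewrite -(is_cycle_rot i) E => /and3P[_ /= pd ud].
rewrite rcons_path in pd; case/andP: pd => pd _.
have -> : count (adj x) c = count (adj x) d.
  by rewrite -(permP (permEl (perm_rot i c))) E /= (negPf nxz).
have sd : size c = (size d).+1 by rewrite -(size_rot i) E.
have dc : {subset d <= c} by move=> w wd; rewrite -(mem_rot i) E inE wd orbT.
have [hx|] := boolP (has (adj x) d); last by rewrite has_count -leqNgt leqn0 => /eqP->.
set j := find (adj x) d.
have jd : j < size d by rewrite -has_find.
have Ej : drop j d = nth x d j :: drop j.+1 d by rewrite (drop_nth x).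
have -> : count (adj x) d = count (adj x) (drop j d).
  rewrite -{1}(cat_take_drop j d) count_cat.
  suff -> : count (adj x) (take j d) = 0 by [].
  apply/eqP; rewrite -leqn0 leqNgt -has_count; apply/hasPn => w /(nthP x)[m].
  rewrite (size_takel (ltnW jd)) => mj <-.
  by rewrite nth_take // (before_find x).
apply: (@count_path_lengths _ S).
- rewrite Ej /= nth_find //=.
  move: pd; rewrite -{1}(cat_take_drop j d) cat_path Ej /=.
  by case/and3P.
- rewrite /= drop_uniq ?andbT; last by case/andP: ud.
  by apply: contra xc => /mem_drop /dc.
- by move=> w; rewrite inE => /orP[/eqP->//|/mem_drop /dc /cS].
- move=> l hl; apply: H; rewrite sd; move: hl; rewrite size_drop => hl.
  by apply: leq_trans hl _; rewrite ltnS leq_subr.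
Qed.

(** * Counting neighbours *)

Definition nbrs_in (G : sgraph) (x : G) (S : {set G}) : nat :=
  #|[set y in S | adj x y]|.

Lemma nbrs_in_path (G : sgraph) x (S : {set G}) (q : seq G) :
  (forall y, y \in S -> adj x y -> y \in q) -> nbrs_in x S <= count (adj x) q.
Proof.
move=> H; rewrite -size_filter; apply: leq_trans (card_size _).
apply/subset_leq_card/subsetP => y; rewrite inE mem_filter => /andP[yS e].
by rewrite e H.
Qed.

Lemma nbrs_in_seq (G : sgraph) (x : G) (c : seq G) :
  nbrs_in x [set y in c] <= count (adj x) c.
Proof. by apply: nbrs_in_path => y; rewrite inE. Qed.

Lemma nbrs_inU (G : sgraph) (x : G) (S T : {set G}) :
  nbrs_in x (S :|: T) <= nbrs_in x S + nbrs_in x T.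
Proof.
rewrite /nbrs_in; apply: leq_trans (leq_card_setU _ _).
apply/subset_leq_card/subsetP => y; rewrite !inE => /andP[/orP[->|->] ->] //.
by rewrite orbT.
Qed.

Lemma nbrs_in_sub (G : sgraph) (x : G) (S T : {set G}) :
  S \subset T -> nbrs_in x S <= nbrs_in x T.
Proof.
move=> /subsetP ST; apply/subset_leq_card/subsetP => y.
by rewrite !inE => /andP[/ST -> ->].
Qed.

Lemma nbrs_in_card (G : sgraph) (x : G) (S : {set G}) : nbrs_in x S <= #|S|.
Proof. by apply/subset_leq_card/subsetP => y; rewrite inE => /andP[]. Qed.

(** * Neighbours of an outside vertex on a cycle *)

Lemma nth_rot (T : Type) (x : T) i k (c : seq T) :
  i < size c -> k < size c -> nth x (rot i c) k = nth x c ((i + k) %% size c).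
Proof.
move=> ic kc; rewrite /rot nth_cat size_drop nth_drop.
case: ltnP => h; first by rewrite modn_small //; lia.
rewrite nth_take; last by lia.
have -> : i + k = (k - (size c - i)) + size c by lia.
by rewrite modnDr modn_small //; lia.
Qed.

Lemma arc_cyc (G : sgraph) (S : {set G}) (c q : seq G) x i a :
  is_cycle c -> {subset c <= S} -> {subset x :: q <= S} ->
  ~~ has (mem c) (x :: q) -> path (@adj G) x q -> uniq (x :: q) ->
  i < size c -> 0 < a <= size c -> 2 <= a + size q ->
  adj (last x q) (nth x c i) -> adj x (nth x c ((i + a.-1) %% size c)) ->
  cyc S (a + (size q).+1).
Proof.
move=> /and3P[c3 cc uc] cS qS dis pq uq ic ac aq e1 e2.
have a1 : a.-1 < size c by lia.
apply/cycP; exists (take a (rot i c) ++ x :: q); split.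
- apply: arc_cycle => //.
  + by rewrite rot_cycle.
  + rewrite cat_uniq rot_uniq uc uq andbT /=.
    by apply: contra dis; rewrite /= (eq_has (a2 := mem c)) ?mem_rot // => z; apply: mem_rot.
  + by rewrite size_rot.
  + by rewrite nth_rot ?addn0 ?modn_small //; lia.
  + by rewrite nth_rot.
- by rewrite size_cat /= size_takel // size_rot; case/andP: ac.
- move=> z; rewrite mem_cat => /orP[/mem_take|/qS //].
  by rewrite mem_rot => /cS.
Qed.

Lemma arc_cyc1 (G : sgraph) (S : {set G}) (c : seq G) x i a :
  is_cycle c -> {subset c <= S} -> x \in S -> x \notin c ->
  i < size c -> 1 < a <= size c ->
  adj x (nth x c i) -> adj x (nth x c ((i + a.-1) %% size c)) ->
  cyc S a.+1.
Proof.
move=> cc cS xS xc ic ac e1 e2; rewrite -addn1.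
apply: (@arc_cyc _ _ c [::] x i a) => //=; try lia.
- by move=> z; rewrite inE => /eqP->.
- by rewrite orbF.
Qed.

(** [I] and its image under [f] are disjoint parts of [J]. This serves to bound sets of positions
    that avoid a translate of themselves. *)
Lemma shifted_size (I J : seq nat) (f : nat -> nat) :
  uniq I -> {in I &, injective f} -> {subset I <= J} ->
  (forall i, i \in I -> (f i \in J) && (f i \notin I)) ->
  2 * size I <= size J.
Proof.
move=> uI fI IJ H.
have -> : 2 * size I = size (I ++ map f I) by rewrite size_cat size_map; lia.
apply: uniq_leq_size.
  rewrite cat_uniq uI map_inj_in_uniq // uI andbT /=.
  by apply/hasPn => i /mapP[j /H /andP[_ h] ->].
move=> i; rewrite mem_cat => /orP[/IJ //|/mapP[j /H /andP[h _] ->]] //.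
Qed.

(** Between two consecutive neighbours on [c], the vertex [x] could be inserted, giving a cycle
    longer by one. So the neighbour positions are disjoint from their cyclic successors. *)
Lemma no_consecutive (G : sgraph) (S : {set G}) (c : seq G) x :
  is_cycle c -> {subset c <= S} -> x \in S -> x \notin c ->
  ~~ cyc S (size c).+1 -> 2 * count (adj x) c <= size c.
Proof.
move=> cc cS xS xc nc; have c3 : 3 <= size c by case/and3P: cc.
rewrite (count_nth x) -size_filter -{2}(size_iota 0 (size c)).
apply: (@shifted_size _ _ (fun i => i.+1 %% size c)).
- by rewrite filter_uniq ?iota_uniq.
- move=> i j; rewrite !mem_filter !mem_iota !add0n => /andP[_ hi] /andP[_ hj].
  by rewrite -[i.+1]addn1 -[j.+1]addn1 => /eqP; rewrite eqn_modDr !modn_small // => /eqP.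
- by move=> i; rewrite mem_filter => /andP[].
- move=> i; rewrite !mem_filter !mem_iota !add0n => /andP[ei hi].
  have m : i.+1 %% size c < size c by rewrite ltn_mod; lia.
  rewrite m andbT /=; apply: contra nc => /andP[ei1 _].
  apply: (@arc_cyc1 _ _ c x (i.+1 %% size c) (size c)) => //; first by lia.
  have -> : (i.+1 %% size c + (size c).-1) %% size c = i => //.
  rewrite modnDml; have -> : i.+1 + (size c).-1 = i + size c by lia.
  by rewrite modnDr modn_small.
Qed.

(* Two neighbours of x at distance 3 on c would give a cycle of length
   size c - 1; and the positions of the neighbours, counted from two steps
   before one of them, are all at most s + 2. *)
Lemma sparse_cycle (G : sgraph) (S : {set G}) (c : seq G) x s :
  is_cycle c -> {subset c <= S} -> x \in S -> x \notin c -> s + 4 <= size c ->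
  (forall l, l < size c -> cyc S l -> l <= s + 2) ->
  2 * count (adj x) c <= s + 6.
Proof.
move=> cc cS xS xc sc H.
have [hx|] := boolP (has (adj x) c); last first.
  by rewrite has_count -leqNgt leqn0 => /eqP->.
have [y yc exy] := hasP hx.
have [i d E] := rot_to yc.
(* With the neighbour [y] at index 2, a later neighbour at index t closes a cycle on exactly t
   vertices. *)
pose c' := rot (size c - 2) (rot i c).
have sc' : size c' = size c by rewrite /c' !size_rot.
have cc' : is_cycle c' by rewrite !is_cycle_rot.
have mc' : c' =i c by move=> z; rewrite !mem_rot.
have cS' : {subset c' <= S} by move=> z; rewrite mc' => /cS.
have xc' : x \notin c' by rewrite mc'.
have e2 : adj x (nth x c' 2).
  rewrite nth_rot ?size_rot; [|lia|lia].
  by have -> : size c - 2 + 2 = size c by [lia]; rewrite modnn E.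
have -> : count (adj x) c = count (adj x) c'.
  by rewrite -(permP (permEl (perm_rot i c))) -(permP (permEl (perm_rot (size c - 2) _))).
have H1 t : t < size c -> adj x (nth x c' t) -> t < s + 3.
  move=> tc et; rewrite ltnNge; apply/negP => st.
  have : cyc S t.
    have -> : t = (t.-2).+2 by lia.
    apply: (@arc_cyc1 _ _ c' x 2 (t.-2).+1) => //; rewrite sc'; [lia|lia|].
    by have -> : 2 + (t.-2).+1.-1 = t by [lia]; rewrite modn_small.
  by move/(H _ tc); lia.
rewrite (count_nth x) -size_filter sc' -[leqRHS](size_iota 0).
(* The neighbour positions are below s + 3, so they and their translates by 3 lie below s + 6. *)
apply: (@shifted_size _ _ (addn 3)).
- by rewrite filter_uniq ?iota_uniq.
- by move=> u v _ _; apply: addnI.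
- move=> t; rewrite mem_filter !mem_iota !add0n => /andP[et tc] /=.
  by have := H1 t tc et; lia.
- move=> t; rewrite !mem_filter !mem_iota !add0n => /andP[et tc] /=.
  have ts := H1 t tc et; apply/andP; split; first by lia.
  apply/negP => /andP[et3 tc3].
  have : cyc S (size c - 2).+1.
    apply: (@arc_cyc1 _ _ c' x (3 + t) (size c - 2)) => //; rewrite sc' //; first by lia.
    have -> : 3 + t + (size c - 2).-1 = t + size c by lia.
    by rewrite modnDr modn_small.
  by move/H => /(_ ltac:(lia)); lia.
Qed.

(** * Longest paths with a constrained last vertex *)

Lemma longest_path (G : sgraph) (R : {set G}) (A : pred G) :
  (exists2 v, v \in R & A v) ->
  exists x q, [/\ path (@adj G) x q, uniq (x :: q), {subset x :: q <= R},
    A (last x q) &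
    forall y p, path (@adj G) y p -> uniq (y :: p) -> {subset y :: p <= R} ->
      A (last y p) -> size p <= size q].
Proof.
move=> [v vR Av].
pose P n := [exists x : G, exists t : n.-tuple G,
  [&& path (@adj G) x t, uniq (x :: t), all (mem R) (x :: t) & A (last x t)]].
have PP y (p : seq G) : path (@adj G) y p -> uniq (y :: p) ->
    {subset y :: p <= R} -> A (last y p) -> P (size p).
  move=> pp up pR Ap; apply/existsP; exists y; apply/existsP.
  by exists (in_tuple p); apply/and4P; split=> //; apply/allP.
have exP : exists n, P n.
  by exists 0; apply: (PP v [::]) => // z; rewrite inE => /eqP->.
have bP n : P n -> n <= #|G|.
  case/existsP=> x /existsP[t /and4P[_ /= /andP[_ ut] _ _]].
  by rewrite -(size_tuple t) -(card_uniqP ut) max_card.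
case: (ex_maxnP exP bP) => n /existsP[x /existsP[t /and4P[pt ut /allP tR At]]] mx.
exists x, t; split=> // y p pp up pR Ap; rewrite size_tuple.
exact: mx _ (PP _ _ pp up pR Ap).
Qed.

(** A neighbour off the path could be put in front of [x] without changing the last vertex, the only
    one that [A] constrains. *)
Lemma longest_path_nbrs (G : sgraph) (R : {set G}) (A : pred G) x (q : seq G) :
  path (@adj G) x q -> uniq (x :: q) -> {subset x :: q <= R} -> A (last x q) ->
  (forall y p, path (@adj G) y p -> uniq (y :: p) -> {subset y :: p <= R} ->
      A (last y p) -> size p <= size q) ->
  forall y, y \in R -> adj x y -> y \in q.
Proof.
move=> pq uq qR Aq mx y yR e; apply: contraT => yq.
have yx : y != x by apply: contraL e => /eqP->; rewrite adj_irrefl.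
suff : (size q).+1 <= size q by rewrite ltnn.
apply: (mx y (x :: q)) => //.
- by rewrite /= adj_sym e.
- by rewrite cons_uniq uq inE negb_or yx yq.
- by move=> z; rewrite inE => /orP[/eqP->//|/qR].
Qed.

(** * Packings and greedy extension *)

(** A boolean recursion, so that existence can be decided and an extremal length picked with
    [ex_maxnP]. Repeated lengths are allowed. *)
Fixpoint pack (G : sgraph) (S : {set G}) (ls : seq nat) : bool :=
  if ls is l :: ls' then
    [exists t : l.-tuple G,
      [&& is_cycle t, all (mem S) t & pack (S :\: [set x in t]) ls']]
  else true.

Lemma pack_cons (G : sgraph) (S : {set G}) (c : seq G) ls :
  is_cycle c -> {subset c <= S} -> pack (S :\: [set x in c]) ls ->
  pack S (size c :: ls).
Proof.
move=> cc cS pl; apply/existsP; exists (in_tuple c).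
by apply/and3P; split=> //; apply/allP.
Qed.

Lemma packP (G : sgraph) (S : {set G}) ls :
  reflect (exists cs : seq (seq G),
    [/\ map size cs = ls, all (@is_cycle G) cs, uniq (flatten cs) &
        {subset flatten cs <= S}]) (pack S ls).
Proof.
apply: (iffP idP); elim: ls S => [|l ls IH] S.
- by move=> _; exists [::].
- case/existsP=> t /and3P[ct /allP tS /IH[cs [sc ac uc cS]]].
  exists (tval t :: cs); split; rewrite /= ?size_tuple ?sc ?ct //.
    rewrite cat_uniq uc andbT; case/and3P: (ct) => _ _ ->.
    apply/hasPn => z /cS; rewrite !inE => /andP[]//.
  by move=> z; rewrite mem_cat => /orP[/tS //|/cS]; rewrite !inE => /andP[].
- by [].
- case=> [[|c cs]] [] // [sc scs] /= /andP[cc ac].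
  rewrite cat_uniq => /and3P[uc /hasPn dis ucs] cS; rewrite -sc.
  apply: pack_cons => //.
    by move=> z zc; apply: cS; rewrite mem_cat zc.
  apply: IH; exists cs; split=> // z zc; rewrite !inE (cS z) ?mem_cat ?zc ?orbT //.
  by rewrite andbT; apply: dis.
Qed.

Lemma pack_sub (G : sgraph) (S T : {set G}) ls : S \subset T -> pack S ls -> pack T ls.
Proof.
move=> /subsetP ST /packP[cs [a b c d]]; apply/packP; exists cs; split=> //.
by move=> z /d /ST.
Qed.

Lemma pack_perm (G : sgraph) (S : {set G}) ls ls' :
  perm_eq ls ls' -> pack S ls -> pack S ls'.
Proof.
move=> pe /packP[cs [a b c d]].
have [cs' E pcs] : exists2 cs', ls' = map size cs' & perm_eq cs' cs.
  rewrite perm_sym in pe; have [Is pI ->] := perm_iotaP 0 pe.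
  exists (map (nth [::] cs) Is); last first.
    by apply/perm_iotaP; exists Is => //; rewrite -a size_map in pI.
  rewrite -map_comp; apply/eq_in_map => i; rewrite (perm_mem pI) mem_iota add0n /=.
  by rewrite -a size_map => ic; rewrite (nth_map [::]).
have pf := perm_flatten pcs.
apply/packP; exists cs'; split; rewrite ?(perm_all _ pcs) ?(perm_uniq pf) //.
by move=> z; rewrite (perm_mem pf) => /d.
Qed.

Lemma pack_cyc (G : sgraph) (S T : {set G}) l ls :
  cyc S l -> pack T ls -> [disjoint S & T] -> pack (S :|: T) (l :: ls).
Proof.
case/cycP=> c [cc <- cS] pT dis; apply: pack_cons => //.
  by move=> z /cS zS; rewrite inE zS.
apply: pack_sub pT; apply/subsetP => z zT; rewrite !inE zT orbT andbT.
by apply/negP => /cS zS; rewrite (disjointFr dis zS) in zT.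
Qed.

(** The packing is restricted to the vertices it uses; their number then bounds the neighbours lost
    to it. *)
Lemma pack_support (G : sgraph) (S : {set G}) ls : pack S ls ->
  exists W : {set G}, [/\ W \subset S, #|W| = sumn ls & pack W ls].
Proof.
case/packP=> cs [a b c d]; exists [set x in flatten cs]; split.
- by apply/subsetP => z; rewrite inE => /d.
- by rewrite cardsE (card_uniqP c) size_flatten /shape a.
- by apply/packP; exists cs; split=> // z; rewrite inE.
Qed.

Lemma pack_uncons (G : sgraph) (S : {set G}) l ls : pack S (l :: ls) ->
  exists c : seq G, [/\ is_cycle c, size c = l, {subset c <= S} &
    pack (S :\: [set x in c]) ls].
Proof.
case/existsP=> t /and3P[ct /allP tS pl]; exists t; split=> //.
by rewrite size_tuple.
Qed.

Lemma pack_has (G : sgraph) (S : {set G}) ls : pack S ls -> uniq ls ->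
  has_disjoint_cycles_of_distinct_lengths G (size ls).
Proof.
case/packP=> cs [E ac uc _] ul.
have sc : size cs = size ls by rewrite -E size_map.
exists (fun i : 'I_(size ls) => nth [::] cs i); split.
- by move=> i; apply: (allP ac); rewrite mem_nth // sc.
- move=> i j ij.
  have H (a b : nat) (ds : seq (seq G)) : uniq (flatten ds) -> a < b -> b < size ds ->
      [disjoint nth [::] ds a & nth [::] ds b].
    elim: ds a b => [|d ds IH] a b //=; rewrite cat_uniq => /and3P[_ /hasPn dis u].
    case: a b => [|a] [|b] //=; rewrite !ltnS; last exact: IH.
    move=> _ bd; rewrite disjoint_sym disjoint_subset; apply/subsetP => z zb.
    rewrite inE; apply/dis/flattenP.
    by exists (nth [::] ds b) => //; apply: mem_nth.
  case: (ltngtP i j) => h.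
  + by apply: H; rewrite ?sc.
  + by rewrite disjoint_sym; apply: H; rewrite ?sc.
  + by move/eqP: ij; case; apply: val_inj.
- move=> i j; apply: contraNneq => e; apply/eqP/val_inj/eqP.
  have := nth_uniq 0 (ltn_ord i) (ltn_ord j) ul.
  by rewrite -[in X in nth _ X _ == _]E -[in X in _ == nth _ X _]E !(nth_map [::]) ?sc // e eqxx.
Qed.

Lemma longest_path_max (G : sgraph) (S : {set G}) : S != set0 ->
  exists x q, [/\ path (@adj G) x q, uniq (x :: q), {subset x :: q <= S} &
    forall y, y \in S -> adj x y -> y \in q].
Proof.
move=> S0; have [e|[v vS]] := set_0Vmem S; first by rewrite e eqxx in S0.
have [|x [q [pq uq qS Aq mx]]] := @longest_path _ S predT; first by exists v.
by exists x, q; split=> //; apply: longest_path_nbrs mx.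
Qed.

(* c is a shortest cycle of S among those longer than m. *)
Lemma next_longer_cycle (G : sgraph) (S : {set G}) (ML : seq nat) m l0 :
  (forall l, l <= m -> cyc S l -> l \in ML) -> 3 <= l0 <= m -> l0 \notin ML ->
  S != set0 -> (forall x, x \in S -> size ML + 3 <= nbrs_in x S) ->
  exists c : seq G,
    [/\ is_cycle c, {subset c <= S}, m < size c,
        forall l, l <= size c -> cyc S l -> l \in size c :: ML &
        S :\: [set z in c] != set0 /\
        forall x, x \in S -> x \notin c -> count (adj x) c <= size ML + 2].
Proof.
move=> HM /andP[l03 l0m] l0ML S0 dS.
(* Otherwise the start of a longest path has too few neighbours, since every length it closes is in
   [ML]. *)
have Hex : exists l, cyc S l && (m < l).
  have [x [q [pq uq qS nq]]] := longest_path_max S0.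
  have [/hasP[l _ /andP[cl ml]]|/hasPn Hn] :=
      boolP (has (fun l => cyc S l && (m < l)) (iota 0 (size q).+2)).
    by exists l; rewrite cl ml.
  have := count_path_lengths (ML := ML) pq uq qS.
  have := leq_trans (dS x (qS _ (mem_head _ _))) (nbrs_in_path nq).
  move=> h1 h2; suff : count (adj x) q <= (size ML).+1 by lia.
  apply: h2 => l lq cl; apply: HM => //; rewrite leqNgt.
  have := Hn l; rewrite mem_iota add0n ltnS lq => /(_ isT).
  by rewrite cl.
case: (ex_minnP Hex) => l /andP[/cycP[c [cc sc cS]] ml] minl.
have Hc l' : l' <= size c -> cyc S l' -> l' \in size c :: ML.
  move=> lc cl; rewrite inE; case: (ltnP m l') => h; last by rewrite HM ?orbT.
  by apply/orP; left; rewrite eqn_leq lc sc minl // cl h.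
have /and3P[c3 cyc_c uc] := cc.
exists c; split=> //; first by rewrite sc.
split.
  (* If [c] covered [S], its first vertex would have at most [size ML + 2] neighbours, all on the
     rest of [c]. *)
  apply/negP => /eqP e.
  have Sc y : y \in S -> y \in c.
    move=> yS; apply: contraT => yc.
    suff : y \in (set0 : {set G}) by rewrite inE.
    by rewrite -e !inE yc.
  case: c cc sc cS Hc c3 cyc_c uc Sc {e} => [//|x q] cc sc cS Hc c3 cyc_c uc Sc.
  move: cyc_c; rewrite /= rcons_path => /andP[pq _].
  have := count_path_lengths (ML := size (x :: q) :: ML) pq uc cS Hc.
  have := dS x (cS _ (mem_head _ _)).
  have : nbrs_in x S <= count (adj x) q.
    apply: nbrs_in_path => y /Sc; rewrite inE => /orP[/eqP->|//].
    by rewrite adj_irrefl.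
  by rewrite /=; lia.
move=> x xS xc.
(* A vertex adjacent to all of [c] would close an arc of l0 - 1 vertices to a cycle of the missing
   length [l0]. *)
have [z zc nz] : exists2 z, z \in c & ~~ adj x z.
  apply/allPn/negP => /allP al.
  suff : l0 \in ML by rewrite (negPf l0ML).
  apply: HM => //; have -> : l0 = (l0.-1).+1 by lia.
  apply: (@arc_cyc1 _ _ c x 0 l0.-1) => //; rewrite ?sc; try lia.
  - by apply/al/mem_nth; apply: ltn_trans c3.
  - by apply/al/mem_nth; rewrite -sc ltn_mod; apply: ltn_trans c3.
have := count_cycle_lengths cc cS xS xc zc nz Hc.
by rewrite /=; lia.
Qed.

(* The sum of c + 2, c + 3, ..., c + j + 1; loss 0 k = k(k + 3)/2. *)
Fixpoint loss c j := if j is j'.+1 then c.+2 + loss c.+1 j' else 0.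

Lemma lossE c j : 2 * loss c j = j * (2 * c + j + 3).
Proof. by elim: j c => [|j IH] c //=; rewrite mulnDr IH; lia. Qed.

Lemma leq_loss c d j : c <= d -> loss c j <= loss d j.
Proof. by elim: j c d => [|j IH] c d //= cd; apply: leq_add => //; apply: IH. Qed.

(** Each removed cycle adds one length to [ML], so the successive cycles cost a remaining vertex at
    most |ML| + 2, |ML| + 3, ... neighbours. The length [l0] stays missing throughout, as each step
    requires. *)
Lemma greedy_cycles (G : sgraph) j : forall (S : {set G}) (ML : seq nat) m l0,
  (forall l, l <= m -> cyc S l -> l \in ML) -> 3 <= l0 <= m -> l0 \notin ML ->
  S != set0 -> (forall x, x \in S -> loss (size ML) j < nbrs_in x S) ->
  exists (T : {set G}) M,
    [/\ T \subset S, pack T M, size M = j, uniq M & all (ltn m) M] /\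
    (S :\: T != set0 /\
     forall x, x \in S :\: T -> nbrs_in x T <= loss (size ML) j).
Proof.
elim: j => [|j IH] S ML m l0 HM l0m l0ML S0 dS.
  exists set0, [::]; split; first by rewrite sub0set.
  rewrite setD0; split=> // x xS /=; rewrite leqn0 cards_eq0.
  by apply/eqP/setP => y; rewrite !inE.
have [|c [cc cS mc Hc [S1 dc]]] := next_longer_cycle HM l0m l0ML S0.
  by move=> x /dS /=; lia.
have l0c : l0 \notin size c :: ML.
  by rewrite inE negb_or l0ML andbT; apply/eqP; lia.
have split_c x (T : {set G}) : nbrs_in x (T :|: [set z in c]) <= nbrs_in x T + count (adj x) c.
  by apply: leq_trans (nbrs_inU _ _ _) _; rewrite leq_add2l nbrs_in_seq.
have [l lc cl||||x xS|T [M [[TS pT sM uM aM] [S2 dT]]]] := IH (S :\: [set z in c]) (size c :: ML) (size c) l0.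
- by apply: Hc => //; apply: cyc_sub cl; apply: subsetDl.
- by lia.
- by [].
- by [].
- move: xS; rewrite !inE => /andP[xc xS].
  have := dS x xS; have := dc x xS xc.
  have : nbrs_in x S <= nbrs_in x (S :\: [set z in c]) + count (adj x) c.
    apply: leq_trans (split_c x _); apply: nbrs_in_sub.
    by apply/subsetP => y yS; rewrite !inE yS; case: (y \in c).
  by rewrite /=; lia.
have eT : S :\: (T :|: [set z in c]) = S :\: [set z in c] :\: T.
  by apply/setP => y; rewrite !inE negb_or andbA.
exists (T :|: [set z in c]), (size c :: M); split; first split.
- rewrite subUset (subset_trans TS (subsetDl _ _)) /=.
  by apply/subsetP => y; rewrite inE => /cS.
- apply: pack_cons => //; first by move=> y yc; rewrite !inE yc orbT.
  apply: pack_sub pT; apply/subsetP => y yT; rewrite !inE yT.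
  by move/subsetP: TS => /(_ y yT); rewrite !inE => /andP[->].
- by rewrite /= sM.
- rewrite /= uM andbT; apply/negP => h; have := allP aM _ h.
  by rewrite /= ltnn.
- rewrite /= mc; apply: sub_all aM => y /=; exact: ltn_trans.
rewrite eT; split=> // x xS; apply: leq_trans (split_c _ _) _.
have := dT x xS; move: xS; rewrite !inE => /and3P[_ xc xS].
by have := dc x xS xc; rewrite /=; lia.
Qed.

(** * Finding the remaining cycles when lengths 3, ..., k + 1 cannot be packed *)

(** If some vertex of [R] has a neighbour on [E], a longest path of [R] ending at such a vertex is
    continued around all of [E]. Otherwise any longest path of [R] will do, with [F] empty. *)
Lemma terminal_path (G : sgraph) (R : {set G}) (E : seq G) :
  R != set0 -> cycle (@adj G) E -> uniq E -> {in E, forall y, y \notin R} ->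
  exists x q F,
    [/\ path (@adj G) x (q ++ F), uniq (x :: q ++ F), {subset x :: q <= R},
        {subset F <= E} &
        (forall y, y \in R -> adj x y -> y \in q) /\
        (forall y, y \in E -> adj x y -> y \in F)].
Proof.
move=> R0 cE uE ER.
have [/existsP[v /andP[vR hv]]|/existsPn no] :=
    boolP [exists v : G, (v \in R) && has (adj v) E].
  have [|x [q [pq uq qR Aq mx]]] := @longest_path _ R (fun v => has (adj v) E).
    by exists v.
  have nq := longest_path_nbrs (A := fun v => has (adj v) E) pq uq qR Aq mx.
  have [e eE le] := hasP Aq; have [i d Ei] := rot_to eE.
  have mE y : (y \in e :: d) = (y \in E) by rewrite -Ei mem_rot.
  exists x, q, (e :: d); split=> //.
  - rewrite cat_path pq /= le /=.
    by move: cE; rewrite -(rot_cycle i) Ei /= rcons_path => /andP[].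
  - have ud : uniq (e :: d) by rewrite -Ei rot_uniq.
    rewrite -cat_cons cat_uniq uq ud andbT andTb.
    by apply/hasPn => y; rewrite mE => yE; apply: contra (ER y yE); apply: qR.
  - by move=> y; rewrite mE.
  - by split=> // y; rewrite mE.
have [x [q [pq uq qR nq]]] := longest_path_max R0.
exists x, q, [::]; split; rewrite ?cats0 //; split=> // y yE e.
have := no x; rewrite qR ?mem_head //= => /hasPn /(_ y yE).
by rewrite e.
Qed.

(* Here E is either nil or a cycle of length s + 2; it is kept out of the greedy
   choice so that the terminal path can end by running around it. *)
Lemma last_cycles (G : sgraph) (R : {set G}) (E : seq G) p s w o fp :
  0 < w -> s <= p -> R != set0 ->
  cycle (@adj G) E -> uniq E -> {in E, forall y, y \notin R} ->
  (forall l, l <= p + 3 -> cyc (R :|: [set y in E]) l -> l \in iota 3 s) ->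
  (forall x, x \in R -> fp + loss p w.+1 <= nbrs_in x (R :|: [set y in E]) + o) ->
  (forall x, x \in R -> loss p w.+1 <= nbrs_in x R + p) ->
  2 * o + minn (2 * s + 4) (s + 6) + 2 * s <= 2 * fp + 4 * p + 5 ->
  exists M, [/\ pack (R :|: [set y in E]) M, size M = w.+1, uniq M &
                all (ltn (p + 3)) M].
Proof.
case: w => [//|w] _ sp R0 cE uE ER HL d1 d2 num.
have HR l : l <= p + 3 -> cyc R l -> l \in iota 3 s.
  by move=> lp cl; apply: HL => //; apply: cyc_sub cl; apply: subsetUl.
have np : p + 3 \notin iota 3 s by rewrite mem_iota; lia.
(* The first cycle is chosen apart from the greedy ones: all shorter cycles of [R] have length at
   most s + 2, so [sparse_cycle] applies to it. *)
have [||c [cc cR pc Hc [R1 dc]]] := next_longer_cycle HR _ np R0.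
- by lia.
- by move=> x /d2; rewrite size_iota /=; lia.
rewrite size_iota in dc.
have c2 x : x \in R -> x \notin c -> 2 * count (adj x) c <= s + 6.
  move=> xR xc; apply: (sparse_cycle cc cR xR xc); first by lia.
  move=> l lc /(Hc _ (ltnW lc)); rewrite inE mem_iota ltn_eqF //=; lia.
have lossS : loss s.+1 w <= loss p.+1 w by apply: leq_loss.
have l2 : loss p w.+2 = p + w + 3 + loss p w.+1.
  by have := lossE p w.+2; have := lossE p w.+1; lia.
have [l lc cl||||x xS|T [M [[TS pT sM uM aM] [S2 dT]]]] :=
   @greedy_cycles _ w (R :\: [set z in c]) (size c :: iota 3 s) (size c) (p + 3).
- by apply: Hc => //; apply: cyc_sub cl; apply: subsetDl.
- by lia.
- by rewrite inE negb_or np andbT; lia.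
- by [].
- move: xS; rewrite !inE /= size_iota => /andP[xc xR].
  have := d2 x xR; have := dc x xR xc.
  have : nbrs_in x R <= nbrs_in x (R :\: [set z in c]) + count (adj x) c.
    apply: leq_trans (leq_add (leqnn _) (nbrs_in_seq x c)).
    apply: leq_trans (nbrs_inU _ _ _); apply: nbrs_in_sub.
    by apply/subsetP => y yS; rewrite !inE yS; case: (y \in c).
  by rewrite /= in l2 *; lia.
rewrite /= size_iota in dT.
set R2 := R :\: [set z in c] :\: T in S2 dT.
have R2R : {subset R2 <= R} by move=> y; rewrite !inE => /and3P[].
have TR : T \subset R by apply: subset_trans TS (subsetDl _ _).
have Tc y : y \in T -> y \notin c.
  by move/subsetP: TS => h /h; rewrite !inE => /andP[].
have ER2 : {in E, forall y, y \notin R2}.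
  by move=> y /ER; apply: contra; apply: R2R.
have [x [q [F [pq uq qR FE [nqR nqE]]]]] := terminal_path S2 cE uE ER2.
have xR2 : x \in R2 by apply/qR/mem_head.
have xR := R2R x xR2; have xc : x \notin c by move: xR2; rewrite !inE => /and3P[].
have R2E : R2 :|: [set y in E] \subset R :|: [set y in E].
  by apply: setSU; apply/subsetP.
(* Either the terminal path yields a new length, which completes the packing, or all lengths it
   closes are known and [x] has too few neighbours. *)
have [/hasP[l _ /andP[cl lM]]|/hasPn Hn] :=
  boolP (has (fun l => cyc (R2 :|: [set y in E]) l &&
                       (l \notin iota 3 s ++ size c :: M)) (iota 0 (size (q ++ F)).+2)).
  move: lM; rewrite mem_cat negb_or => /andP[ls lM].
  have pl : p + 3 < l.
    rewrite ltnNge; apply: contra ls => lp; apply: HL => //.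
    exact: cyc_sub cl.
  exists (l :: size c :: M); split.
  - have : pack (R2 :|: [set y in E] :|: (T :|: [set y in c])) (l :: size c :: M).
      apply: pack_cyc cl _ _.
        apply: pack_cons => //; first by move=> y yc; rewrite !inE yc orbT.
        apply: pack_sub pT; apply/subsetP => y yT; rewrite !inE yT /=.
        by rewrite Tc.
      rewrite disjoint_subset; apply/subsetP => y; rewrite !inE negb_or.
      case/orP=> [/and3P[-> -> //]|yE].
      have yR := ER y yE; apply/andP; split.
        by apply: contra yR; apply/subsetP.
      by apply: contra yR; apply: cR.
    apply: pack_sub; rewrite !subUset (subset_trans (subsetUl _ _) R2E) subsetUr /=.
    rewrite (subset_trans TR (subsetUl _ _)) /=.
    by apply/subsetP => y; rewrite !inE => /cR ->.
  - by rewrite /= sM.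
  - rewrite /= lM uM andbT; apply/negP => h.
    by have := allP aM _ h; rewrite /= ltnn.
  - rewrite /= pl pc /=; apply: sub_all aM => y /=; exact: ltn_trans.
exfalso.
have qFS : {subset x :: q ++ F <= R2 :|: [set y in E]}.
  move=> y; rewrite -cat_cons mem_cat in_setU !inE -[(y == x) || _]/(y \in x :: q).
  by case/orP=> [/qR|/FE ->]; rewrite ?inE ?orbT // => ->.
have h1 : nbrs_in x (R2 :|: [set y in E]) <= count (adj x) (q ++ F).
  apply: nbrs_in_path => y; rewrite in_setU [y \in [set _ in E]]inE mem_cat.
  by case/orP=> [/nqR h|/nqE h] /h ->; rewrite ?orbT.
have h2 : count (adj x) (q ++ F) <= (size (iota 3 s ++ size c :: M)).+1.
  apply: (count_path_lengths pq uq qFS) => l lq cl.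
  have := Hn l; rewrite mem_iota add0n ltnS lq => /(_ isT).
  by rewrite cl negbK.
rewrite size_cat size_iota /= sM in h2.
have h3 : nbrs_in x (R :|: [set y in E]) <=
    nbrs_in x (R2 :|: [set y in E]) + (nbrs_in x T + count (adj x) c).
  apply: leq_trans (leq_add (leqnn _) (leq_add (leqnn _) (nbrs_in_seq x c))).
  apply: leq_trans (leq_add (leqnn _) (nbrs_inU _ _ _)).
  apply: leq_trans (nbrs_inU _ _ _); apply: nbrs_in_sub.
  apply/subsetP => y; rewrite !inE.
  by case: (y \in R); case: (y \in c); case: (y \in T); case: (y \in E).
have h4 := dT x xR2; have h5 := dc x xR xc; have h6 := c2 x xR xc.
(* Where the lemma is applied, [fp] is [loss 0 p] and [o] bounds the neighbours outside [R] and
   [E]. *)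
have h7 := d1 x xR; rewrite l2 /= in h7.
have h8 : 2 * count (adj x) c <= minn (2 * s + 4) (s + 6).
  by rewrite leq_min h6 andbT; move: h5; clear; lia.
move: num lossS h1 h2 h3 h4 h7 h8; clear.
move: (minn _ _) (loss s.+1 w) (loss p.+1 w) (count (adj x) c) (nbrs_in x T)
      (nbrs_in x (R2 :|: _)) (nbrs_in x (R :|: _)) (count (adj x) _).
lia.
Qed.

(** * Excluding a maximal pair of equal cycles *)

(** Reversing the path swaps its ends; together with [arc_cyc], both arcs between two vertices of
    [c] can be closed. *)
Lemma arc_cyc_rev (G : sgraph) (S : {set G}) (c q : seq G) x i a :
  is_cycle c -> {subset c <= S} -> {subset x :: q <= S} ->
  ~~ has (mem c) (x :: q) -> path (@adj G) x q -> uniq (x :: q) ->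
  i < size c -> 0 < a <= size c -> 2 <= a + size q ->
  adj x (nth x c i) -> adj (last x q) (nth x c ((i + a.-1) %% size c)) ->
  cyc S (a + (size q).+1).
Proof.
move=> cc cS qS dis pq uq ic ac aq e1 e2.
have E : last x q :: rev (belast x q) = rev (x :: q) by rewrite [x :: q]lastI rev_rcons.
have c3 : 0 < size c by apply: leq_trans ic.
have sq : size (rev (belast x q)) = size q by rewrite size_rev size_belast.
have l2 : last (last x q) (rev (belast x q)) = x.
  by case: (q) => [|z p] //=; rewrite rev_cons last_rcons.
rewrite -sq; apply: (@arc_cyc _ _ c _ (last x q) i a) => //.
- by move=> z; rewrite E mem_rev; apply: qS.
- by rewrite E has_rev.
- rewrite rev_path; rewrite (eq_path (e' := @adj G)) // => u v.
  by rewrite adj_sym.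
- by rewrite E rev_uniq.
- by rewrite sq.
- by rewrite l2 (set_nth_default x).
- by rewrite (set_nth_default x) // ltn_mod.
Qed.

Lemma farthest (T : Type) (x0 : T) (a : pred T) s : has a s ->
  exists i, [/\ i < size s, a (nth x0 s i) & count a s <= i.+1].
Proof.
elim/last_ind: s => [|s z IH] //; rewrite has_rcons -cats1 count_cat /= addn0.
have [az _|az /= /IH[i [ic ai ci]]] := boolP (a z).
  exists (size s); split; rewrite ?size_cat ?addn1 //.
    by rewrite nth_cat ltnn subnn.
  by rewrite ltnS count_size.
exists i; split; rewrite ?addn0 // ?size_cat ?nth_cat ?ic //.
by rewrite ltn_addr.
Qed.

(* R is what remains of the graph after removing a packing with lengths
   3, ..., k + 1 in which C and an extra cycle E have the same length l. *)
Lemma no_maximal_pair (G : sgraph) (R : {set G}) (C E : seq G) l :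
  R != set0 -> is_cycle C -> is_cycle E -> size C = l -> size E = l ->
  {in C, forall y, y \notin R} -> {in E, forall y, y \notin R} ->
  (forall l', l < l' -> ~~ cyc (R :|: [set y in C]) l') ->
  (forall l', l < l' -> ~~ cyc (R :|: [set y in E]) l') ->
  (forall x, x \in R ->
     l + 2 <= count (adj x) C + count (adj x) E + nbrs_in x R) ->
  False.
Proof.
move=> R0 cC cE sC sE CR ER HC HE D.
have l3 : 3 <= l by case/and3P: (cC); rewrite sC.
have CS : {subset C <= R :|: [set y in C]} by move=> y; rewrite !inE orbC => ->.
have ES : {subset E <= R :|: [set y in E]} by move=> y; rewrite !inE orbC => ->.
have RC : {subset R <= R :|: [set y in C]} by move=> y; rewrite !inE => ->.
have RE : {subset R <= R :|: [set y in E]} by move=> y; rewrite !inE => ->.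
have HR l' : cyc R l' -> l' <= l.
  move=> cl; rewrite leqNgt; apply/negP => /HC; apply/negP; rewrite negbK.
  by apply: cyc_sub cl; apply: subsetUl.
have a2 x : x \in R -> 2 * count (adj x) C <= l.
  move=> xR; rewrite -sC; apply: (no_consecutive cC CS (RC _ xR)).
    by apply: contraL xR; apply: CR.
  by apply: HC; rewrite sC.
(* The path must end next to [E] only if some vertex of [R] has a neighbour there, so that such a
   path always exists. *)
pose att := [exists v : G, (v \in R) && has (adj v) E].
pose A := fun v : G => att ==> has (adj v) E.
have exA : exists2 v, v \in R & A v.
  have [/existsP[v /andP[vR hv]]|no] := boolP att.
    by exists v => //; rewrite /A hv implybT.
  have [e|[v vR]] := set_0Vmem R; first by rewrite e eqxx in R0.
  by exists v => //; rewrite /A (negPf no).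
have [x [q [pq uq qR Aq mx]]] := longest_path exA.
(* The end y of a longest path has at most one neighbour on E, hence many on
   the path itself. *)
have claim y p : path (@adj G) y p -> uniq (y :: p) -> {subset y :: p <= R} ->
    A (last y p) -> size p = size q ->
    2 <= count (adj y) C /\
    exists i, [/\ i < size p, adj y (nth y p i), i.+2 <= l & l <= 2 * i].
  move=> pp up pR Ap sp.
  have yR : y \in R := pR _ (mem_head _ _).
  have np : nbrs_in y R <= count (adj y) p.
    apply/nbrs_in_path/(longest_path_nbrs (A := A)) => //.
    by move=> z r pr ur rR Ar; rewrite sp; exact: (mx _ _ pr ur rR Ar).
  have cp : count (adj y) p <= size p := count_size _ _.
  have Dy := D y yR; have ay := a2 y yR.
  have E1 : count (adj y) E <= 1.
    have [ha|ha] := boolP att; last first.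
      move/existsPn: ha => /(_ y); rewrite yR /= has_count -leqNgt leqn0.
      by move/eqP->.
    have [e eE le] : exists2 e, e \in E & adj (last y p) e.
      by move: Ap; rewrite /A ha => /hasP.
    have [j d Ej] := rot_to eE.
    pose F := rot j E.
    have mF z : (z \in F) = (z \in E) by rewrite mem_rot.
    have cF : is_cycle F by rewrite is_cycle_rot.
    have sF : size F = l by rewrite size_rot.
    have FS : {subset F <= R :|: [set y in E]} by move=> z; rewrite mF => /ES.
    have dis : ~~ has (mem F) (y :: p).
      by apply/hasPn => z /pR zR; rewrite inE mF; apply: contraL zR; apply: ER.
    have pS : {subset y :: p <= R :|: [set y in E]} by move=> z /pR /RE.
    have -> : count (adj y) E = count (adj y) F by apply/esym/permP/permEl/perm_rot.
    rewrite [F]Ej /= -[leqRHS]addn0 leq_add ?leq_b1 //.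
    rewrite (count_nth y) -size_filter.
    set I := filter _ _.
    have sd : l = (size d).+1 by rewrite -sF /F Ej.
    (* The path joins [y] to the first vertex of [F]. Closing both arcs between that vertex and a
       further neighbour of [y] gives cycles of length at most l, which confines t from both
       sides. *)
    have HI t : t \in I -> [/\ adj y (nth y F t.+1), size p < t & t + size p + 2 < l].
      rewrite mem_filter mem_iota add0n => /andP[/= et td].
      have tl : t.+1 < l by rewrite sd.
      have et' : adj y (nth y F t.+1) by rewrite /F Ej.
      have F0 : adj (last y p) (nth y F 0) by rewrite /F Ej.
      have h1 : cyc (R :|: [set y in E]) (t.+2 + (size p).+1).
        apply: (arc_cyc cF FS pS dis pp up (i := 0)); rewrite ?sF ?sd //.
        by rewrite add0n modn_small.
      have h2 : cyc (R :|: [set y in E]) (l - t + (size p).+1).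
        have lt : t.+1 + (l - t).-1 = l by clear -tl; lia.
        have at1 : 0 < l - t <= size F by rewrite sF; clear -tl; lia.
        have at2 : 2 <= l - t + size p by clear -tl; lia.
        apply: (arc_cyc_rev cF FS pS dis pp up _ at1 at2 et') => //; rewrite sF ?sd //.
        by rewrite -sd lt modnn.
      split=> //.
        by rewrite ltnNge; apply: contraL h2 => h; apply: HE; clear -h tl; lia.
      by rewrite ltnNge; apply: contraL h1 => h; apply: HE; clear -h tl; lia.
    have uI : uniq I by rewrite filter_uniq ?iota_uniq.
    (* Neighbours are not consecutive, so at most l/2 - size p - 1 such t exist. With l/2 neighbours
       on [C], one more on [E] and [size p] in [R], the degree of [y] is then too small. *)
    have sI : 2 * size I <= size (iota (size p).+1 (l - 2 * size p - 2)).
      apply: (@shifted_size _ _ S) => //.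
      - by move=> u v _ _ [].
      - by move=> t /HI[_ h1 h2]; rewrite mem_iota; clear -h1 h2; lia.
      - move=> t tI; have [et h1 h2] := HI t tI.
        rewrite mem_iota; apply/andP; split; first by clear -h1 h2; lia.
        apply/negP => /HI[et1 _ h3].
        have : cyc (R :|: [set y in E]) l.+1.
          have yF : y \notin F by rewrite mF; apply: contraL yR; apply: ER.
          have lt : t.+2 + l.-1 = t.+1 + l by clear -l3; lia.
          rewrite -sF; apply: (arc_cyc1 cF FS (RE _ yR) yF _ _ et1).
          + by rewrite sF; clear -h3; lia.
          + by rewrite sF leqnn (leq_trans _ l3).
          + by rewrite sF lt modnDr modn_small //; clear -h3; lia.
        by apply/negP/HE.
    rewrite size_iota in sI.
    have cE1 : count (adj y) E <= 1 + size I.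
      have -> : count (adj y) E = count (adj y) F by apply/esym/permP/permEl/perm_rot.
      by rewrite [F]Ej /= leq_add ?leq_b1 // (count_nth y) -size_filter.
    rewrite leqNgt; apply/negP => I0.
    have [t tI] : exists t, t \in I by case: (I) I0 => // t I' _; exists t; rewrite mem_head.
    have [_ h1 h2] := HI t tI.
    by move: (leq_trans np cp) Dy ay cE1 sI h1 h2; clear; lia.
  have hp : has (adj y) p by rewrite has_count; move: np Dy ay E1 l3; clear; lia.
  have [i [ip ei ci]] := farthest y hp.
  have il : i.+2 <= l.
    have i0 : 0 < i by move: ci np Dy ay E1 l3; clear; lia.
    apply: HR; apply/cycP; exists (y :: take i.+1 p); split.
    - by apply: chord_cycle; rewrite // i0 ip.
    - by rewrite /= size_takel.
    - move=> z; rewrite inE => /orP[/eqP->//|/mem_take zp].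
      by apply: pR; rewrite inE zp orbT.
  (* By the choice of i, [y] has at most i + 1 <= l - 1 neighbours in [R] and one on [E], which
     leaves two for [C]. *)
  split; first by move: ci np Dy E1 il; clear; lia.
  by exists i; split=> //; move: ci np Dy ay E1; clear; lia.
have [ax [i [iq ei il li]]] := claim x q pq uq qR Aq erefl.
(* Rotation: [y] precedes [nth x q i], and going from [y] back to [x], then along the chord and on,
   gives a path with the same vertices and the same last vertex. *)
pose q1 := take i q; pose y := last x q1.
have sq1 : size q1 = i by rewrite size_takel // ltnW.
have pq1 : path (@adj G) x q1 by move: pq; rewrite -(cat_take_drop i q) cat_path => /andP[].
have Ed : drop i q = nth x q i :: drop i.+1 q by rewrite (drop_nth x).
pose p := rev (belast x q1) ++ drop i q.
have Ep : y :: p = rev (x :: q1) ++ drop i q by rewrite -cat_cons [x :: q1]lastI rev_rcons.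
have pe : perm_eq (y :: p) (x :: q).
  by rewrite Ep -{2}(cat_take_drop i q) -cat_cons perm_cat2r perm_rev.
have lr : last y (rev (belast x q1)) = x.
  by rewrite /y; case: (q1) => [|z r] //=; rewrite rev_cons last_rcons.
have lp : last y p = last x q.
  by rewrite last_cat lr -{2}(cat_take_drop i q) last_cat Ed.
have ay : 2 <= count (adj y) C.
  have [|||||//] := claim y p.
  - rewrite cat_path lr rev_path (eq_path (e' := @adj G)) ?pq1 /=; last first.
      by move=> u v; rewrite adj_sym.
    rewrite Ed /= ei; move: pq; rewrite -{1}(cat_take_drop i q) cat_path Ed /=.
    by case/and3P.
  - by rewrite (perm_uniq pe).
  - by move=> z; rewrite (perm_mem pe); apply: qR.
  - by rewrite lp.
  - by have := perm_size pe; case.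
have [v vC ev] : exists2 v, v < l & adj y (nth x C v).
  have : has (adj y) C by rewrite has_count; apply: leq_trans ay.
  by case/(has_nthP x) => v; rewrite sC; exists v.
have [u uC /andP[uv eu]] : exists2 u, u < l & (u != v) && adj x (nth x C u).
  have [/hasP[u]|/hasPn no] := boolP (has (fun u => (u != v) && adj x (nth x C u)) (iota 0 l)).
    by rewrite mem_iota add0n /=; exists u.
  suff : count (adj x) C <= 1 by move/(leq_trans ax).
  rewrite (count_nth x) -size_filter -[1]/(size [:: v]).
  apply: uniq_leq_size; first by rewrite filter_uniq ?iota_uniq.
  move=> t; rewrite mem_filter sC inE => /andP[et /no].
  by rewrite et andbT negbK.
have q1R : {subset x :: q1 <= R}.
  move=> z; rewrite inE => /orP[/eqP->|/mem_take zq]; apply: qR.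
    exact: mem_head.
  by rewrite inE zq orbT.
have q1S : {subset x :: q1 <= R :|: [set y in C]} by move=> z /q1R /RC.
have dis : ~~ has (mem C) (x :: q1).
  by apply/hasPn => z /q1R zR; rewrite inE; apply: contraL zR; apply: CR.
have uq1 : uniq (x :: q1) by apply: subseq_uniq uq; rewrite /= eqxx take_subseq.
(* [g] is the distance from [u] to [v] around [C]. Closing either arc with the i + 1 vertices of
   [x :: q1] gives two lengths with sum l + 2i + 4 > 2l, so one exceeds l. *)
pose g := if u < v then v - u else v + l - u.
have gl : 0 < g < l by rewrite /g; case: (ltngtP u v) uv => // h _; clear -h uC vC; lia.
have gv : (u + g) %% l = v.
  rewrite /g; case: (ltngtP u v) uv => // h _.
    by have -> : u + (v - u) = v by [clear -h; lia]; rewrite modn_small.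
  by have -> : u + (v + l - u) = v + l by [clear -uC; lia]; rewrite modnDr modn_small.
have gu : (v + (l - g)) %% l = u.
  rewrite /g; case: (ltngtP u v) uv => // h _.
    by have -> : v + (l - (v - u)) = u + l by [clear -h vC; lia]; rewrite modnDr modn_small.
  by have -> : v + (l - (v + l - u)) = u by [clear -h uC; lia]; rewrite modn_small.
have h1 : cyc (R :|: [set y in C]) (g.+1 + i.+1).
  rewrite -sq1; apply: (arc_cyc_rev cC CS q1S dis pq1 uq1 _ _ _ eu).
  - by rewrite sC.
  - by rewrite sC; case/andP: gl.
  - by rewrite sq1; clear -li l3; lia.
  - by rewrite sC gv.
have h2 : cyc (R :|: [set y in C]) ((l - g).+1 + i.+1).
  rewrite -sq1; apply: (arc_cyc cC CS q1S dis pq1 uq1 (i := v)).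
  - by rewrite sC.
  - by rewrite sC; clear -gl; lia.
  - by rewrite sq1; clear -li l3; lia.
  - exact: ev.
  - by rewrite sC gu.
have := contraL (HC (g.+1 + i.+1)) h1; have := contraL (HC ((l - g).+1 + i.+1)) h2.
by move: gl li; clear; move: g => n; lia.
Qed.

(** * The degree condition forces the packing *)

Lemma pack_cat (G : sgraph) (S T : {set G}) ls ls' :
  pack S ls -> pack T ls' -> [disjoint S & T] -> pack (S :|: T) (ls ++ ls').
Proof.
move=> pS pT; elim: ls S pS => [|l ls IH] S /=.
  by move=> _ _; apply: pack_sub pT; apply: subsetUr.
move/pack_uncons=> [c [cc <- cS pS]] dis; apply: pack_cons => //.
  by move=> y /cS yS; rewrite inE yS.
apply: pack_sub (IH _ pS (disjointWl (subsetDl _ _) dis)).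
apply/subsetP => y; rewrite !inE; case/orP=> [/andP[-> ->]//|yT].
rewrite yT orbT andbT; apply: contraL yT => /cS yS.
by rewrite (disjointFr dis yS).
Qed.

Lemma cyc_max (G : sgraph) (S : {set G}) l : cyc S l -> l <= #|G|.
Proof.
by case/cycP=> c [/and3P[_ _ uc] <- _]; rewrite -(card_uniqP uc) max_card.
Qed.

Lemma sumn_iota3 p : sumn (iota 3 p) = loss 0 p + p.
Proof.
have H m : sumn (iota m.+3 p) = loss m p + p.
  by elim: p m => [|p IH] m //=; rewrite IH; lia.
exact: H.
Qed.

Lemma loss_add p w : loss 0 (p + w) = loss 0 p + loss p w.
Proof.
have := lossE 0 (p + w); have := lossE 0 p; have := lossE p w; nia.
Qed.

Lemma first_failure (P : pred nat) k : P 0 ->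
  P k \/ exists p, [/\ p < k, P p & ~~ P p.+1].
Proof.
move=> P0; elim: k => [|k [Pk|[p [pk Pp nP]]]]; first by left.
  by have [h|h] := boolP (P k.+1); [left|right; exists k].
by right; exists p; split=> //; apply: ltnW.
Qed.

(** k(k + 5)/2 is one more than the number of vertices in cycles of lengths 3, ..., k + 1 and a
    second cycle of length k + 1. *)
Lemma order_large k : 1 < k -> k * (k + 5) <= 2 * (7 * (k ^ 2 %/ 4)).
Proof.
move=> k2.
have [m [m1 [E|E]]] : exists m, 0 < m /\ (k = 2 * m \/ k = 2 * m + 1).
  exists (k %/ 2); split; first by lia.
  lia.
- have -> : k ^ 2 %/ 4 = m * m by rewrite E -mulnn; lia.
  by rewrite E; nia.
- have -> : k ^ 2 %/ 4 = m * m + m by rewrite E -mulnn; lia.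
  by rewrite E; nia.
Qed.

Lemma packing_of_degree (G : sgraph) k : 1 < k ->
  k * (k + 5) <= 2 * #|G| ->
  (forall x : G, loss 0 k <= nbrs_in x [set: G]) ->
  has_disjoint_cycles_of_distinct_lengths G k.
Proof.
move=> k2 kG deg.
have [Pk|[p [pk Pp nP]]] := @first_failure (fun p => pack [set: G] (iota 3 p)) k isT.
  by rewrite -[k in has_disjoint_cycles_of_distinct_lengths _ k](size_iota 3); apply: (pack_has Pk); apply: iota_uniq.
have n3 : ~~ pack [set: G] (p + 3 :: iota 3 p).
  apply: contra nP; apply: pack_perm.
  by rewrite -[p.+1]addn1 iotaD /= addnC cats1 perm_sym perm_rcons.
have finish M : pack [set: G] (M ++ iota 3 p) -> size M = k - p -> uniq M ->
    all (ltn (p + 3)) M -> has_disjoint_cycles_of_distinct_lengths G k.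
  move=> pM sM uM aM.
  have -> : k = size (M ++ iota 3 p) by rewrite size_cat sM size_iota subnK // ltnW.
  apply: (pack_has pM); rewrite cat_uniq uM iota_uniq andbT /=.
  apply/hasPn => l; rewrite mem_iota => lp; apply/negP => /(allP aM) /=.
  by move: lp; clear; lia.
(* The packing and one more cycle of length at most p + 2 leave a vertex over: by the order if p = k
   - 1, by the degree otherwise. *)
have Gp : sumn (iota 3 p) + (p + 2) < #|G|.
  rewrite sumn_iota3; have := lossE 0 p; move: pk; rewrite leq_eqVlt => /orP[/eqP pk|pk].
    by move: kG; rewrite -pk; clear; nia.
  have [v _] : exists v : G, true.
    have /card_gt0P[v _] : 0 < #|G| by move: kG k2; clear; nia.
    by exists v.
  have h : loss 0 k <= #|G|.
    by apply: leq_trans (deg v) _; apply: leq_trans (nbrs_in_card _ _) _; rewrite cardsT.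
  have := lossE 0 k; move: h pk; clear; nia.
have degU x (S T : {set G}) : S :|: T = [set: G] -> loss 0 k <= nbrs_in x S + nbrs_in x T.
  by move=> e; apply: leq_trans (deg x) _; rewrite -e nbrs_inU.
have [w kw] : exists w, k = p + w.+1 by exists (k - p.+1); clear -pk; lia.
have Ek : loss 0 k = loss 0 p + loss p w.+1 by rewrite kw loss_add.
have [/hasP[l0 _ /andP[Pl0 l0p]]|/hasPn nol] :=
  boolP (has (fun l => pack [set: G] (l :: iota 3 p) && (l <= p + 2)) (iota 0 (p + 3))).
- have ex : exists l, pack [set: G] (l :: iota 3 p) && (l <= p + 2).
    by exists l0; rewrite Pl0.
  have bl l : pack [set: G] (l :: iota 3 p) && (l <= p + 2) -> l <= p + 2 by case/andP.
  case: (ex_maxnP ex bl) => {l0 Pl0 l0p} l /andP[Pl lp] maxl.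
  have l3 : 3 <= l by have [c [/and3P[h _ _] <- _ _]] := pack_uncons Pl.
  have li : l \in iota 3 p by rewrite mem_iota; clear -l3 lp; lia.
  have pr := perm_to_rem li; set rest := rem l (iota 3 p) in pr.
  (* Since l occurs twice, [C] and [E] can be exchanged; [W] will carry the other cycles. *)
  have : pack [set: G] (l :: l :: rest) by apply: pack_perm Pl; rewrite perm_cons.
  case/pack_uncons=> C [cC sC _] /pack_uncons[E [cE sE ES]].
  case/pack_support=> W [WS cW pW].
  have sW : #|W| + l = loss 0 p + p.
    by rewrite cW -sumn_iota3 (perm_sumn pr) /= addnC.
  have CW y : y \in W -> y \notin C.
    by move/subsetP: WS => h /h; rewrite !inE => /and3P[].
  have EW y : y \in W -> y \notin E.
    by move/subsetP: WS => h /h; rewrite !inE => /and3P[].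
  have CE y : y \in E -> y \notin C by move/ES; rewrite !inE => /andP[].
  pose R := ~: (W :|: [set y in C] :|: [set y in E]).
  have RW y : y \in R -> [/\ y \notin W, y \notin C & y \notin E].
    by rewrite !inE !negb_or => /andP[/andP[]].
  have CR : {in C, forall y, y \notin R} by move=> y yC; apply/negP => /RW[_]; rewrite yC.
  have ER : {in E, forall y, y \notin R} by move=> y yE; apply/negP => /RW[_ _]; rewrite yE.
  have R0 : R != set0.
    apply/eqP => R0.
    have hG : #|W :|: [set y in C] :|: [set y in E]| = #|G|.
      have <- : ~: R = W :|: [set y in C] :|: [set y in E] by rewrite setCK.
      by rewrite R0 setC0 cardsT.
    have h1 := leq_card_setU (W :|: [set y in C]) [set y in E].
    have h2 := leq_card_setU W [set y in C].
    have h3 : #|[set y in C]| <= l by rewrite cardsE -sC card_size.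
    have h4 : #|[set y in E]| <= l by rewrite cardsE -sE card_size.
    have := leq_trans h1 (leq_add (leq_trans h2 (leq_add (leqnn _) h3)) h4).
    rewrite hG => h5; move: h5 sW lp Gp; rewrite sumn_iota3; clear.
    by move: #|W| #|G|; lia.
  have disE : [disjoint R :|: [set y in E] & W :|: [set y in C]].
    rewrite disjoint_subset; apply/subsetP => y; rewrite [y \in _ :|: _]inE.
    case/orP=> [/RW[h1 h2 _]|]; rewrite !inE ?negb_or ?h1 ?h2 // => yE.
    by rewrite CE // andbT; apply: contraL yE; apply: EW.
  have disC : [disjoint R :|: [set y in C] & W :|: [set y in E]].
    rewrite disjoint_subset; apply/subsetP => y; rewrite [y \in _ :|: _]inE.
    case/orP=> [/RW[h1 _ h2]|]; rewrite !inE ?negb_or ?h1 ?h2 // => yC.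
    apply/andP; split; first by apply: contraL yC; apply: CW.
    by apply: contraL yC; apply: CE.
  have packX (S : {set G}) M (X : seq G) : is_cycle X -> size X = l ->
      (forall y, y \in W -> y \notin X) ->
      pack S M -> [disjoint S & W :|: [set y in X]] -> pack [set: G] (M ++ iota 3 p).
    move=> cX sX XW pS dis.
    have pX : pack (W :|: [set y in X]) (l :: rest).
      rewrite -sX; apply: pack_cons => //; first by move=> y; rewrite !inE orbC => ->.
      by apply: pack_sub pW; apply/subsetP => y yW; rewrite !inE yW XW.
    have := pack_sub (subsetT _) (pack_cat pS pX dis).
    by apply: pack_perm; rewrite perm_cat2l perm_sym.
  have cyc_pack (S : {set G}) m : cyc S m -> pack S [:: m].
    by case/cycP=> c [cc <- cS]; apply: pack_cons.
  have HEp m : cyc (R :|: [set y in E]) m -> pack [set: G] (m :: iota 3 p).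
    by move=> /cyc_pack h; apply: (packX _ [:: m] C cC sC CW h disE).
  have HCp m : cyc (R :|: [set y in C]) m -> pack [set: G] (m :: iota 3 p).
    by move=> /cyc_pack h; apply: (packX _ [:: m] E cE sE EW h disC).
  (* By maximality of l, and because the length p + 3 cannot be added. *)
  have small m : pack [set: G] (m :: iota 3 p) -> m <= p + 3 -> m <= l.
    move=> pm; rewrite leq_eqVlt => /orP[/eqP e|mp].
      by rewrite -e pm in n3.
    by apply: maxl; rewrite pm; clear -mp; lia.
  have a2 x (X : seq G) : is_cycle X -> size X = l -> x \in R -> x \notin X ->
      (forall m, cyc (R :|: [set y in X]) m -> pack [set: G] (m :: iota 3 p)) ->
      2 * count (adj x) X <= l.
    move=> cX sX xR xX HX; rewrite -sX; apply: (@no_consecutive _ (R :|: [set y in X])) => //.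
    - by move=> y; rewrite !inE orbC => ->.
    - by rewrite inE xR.
    - apply/negP => /HX; rewrite sX => /small; clear -lp; lia.
  case: (posnP w) => [w0|w0].
    have kp : k = p.+1 by rewrite kw w0 addn1.
    have [/hasP[m _ /andP[pm mp]]|/hasPn nom] :=
      boolP (has (fun m => pack [set: G] (m :: iota 3 p) && (p + 3 < m)) (iota 0 #|G|.+1)).
      by apply: (finish [:: m]) => //=; rewrite ?mp // kp subSnn.
    have big m (S : {set G}) : l < m -> cyc S m -> pack [set: G] (m :: iota 3 p) -> False.
      move=> lm cm pm; have := nom m; rewrite mem_iota add0n ltnS (cyc_max cm) => /(_ isT).
      rewrite pm /= -leqNgt => /(small _ pm); rewrite leqNgt lm //.
    exfalso; apply: (no_maximal_pair R0 cC cE sC sE CR ER).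
    - by move=> m lm; apply/negP => cm; apply: (big m _ lm cm); apply: HCp.
    - by move=> m lm; apply/negP => cm; apply: (big m _ lm cm); apply: HEp.
    - move=> x xR.
      have h : loss 0 k <= nbrs_in x R + nbrs_in x (W :|: [set y in C] :|: [set y in E]).
        by apply: degU; rewrite setUC setUCr.
      have h1 := nbrs_inU x (W :|: [set y in C]) [set y in E].
      have h2 := nbrs_inU x W [set y in C].
      have h3 := nbrs_in_seq x C; have h4 := nbrs_in_seq x E.
      have h5 := nbrs_in_card x W.
      (* The degree is at least [loss 0 p] + p + 2, while [W] has [loss 0 p] + p - l vertices; l + 2
         neighbours remain. *)
      rewrite Ek w0 /= in h.
      have := leq_trans h (leq_add (leqnn _) (leq_trans h1 (leq_add (leq_trans h2 (leq_add h5 h3)) h4))).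
      by move: sW; clear; lia.
  (* The known lengths 3, ..., l are [iota 3 (l - 2)]; at most |W| + l/2 neighbours lie outside [R]
     and [E]. *)
  have [||||x xR|x xR||M [pM sM uM aM]] :=
    @last_cycles G R E p (l - 2) w (#|W| + l %/ 2) (loss 0 p) w0 _ R0 _ _ ER.
  - by clear -lp; lia.
  - by case/and3P: cE.
  - by case/and3P: cE.
  - move=> m mp cm; rewrite mem_iota (cyc_ge3 cm) /=.
    by have := small m (HEp m cm) mp; clear -l3; lia.
  - have [_ xC _] := RW x xR.
    have h : loss 0 k <= nbrs_in x (R :|: [set y in E]) + nbrs_in x (W :|: [set y in C]).
      apply: degU; apply/setP => y; rewrite !inE.
      by case: (y \in W); case: (y \in C); case: (y \in E).
    have h2 := leq_trans (nbrs_inU x W [set y in C]) (leq_add (nbrs_in_card x W) (nbrs_in_seq x C)).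
    have h3 := a2 x C cC sC xR xC HCp.
    have h4 : count (adj x) C <= l %/ 2 by clear -h3; lia.
    rewrite Ek in h; apply: leq_trans h _; rewrite leq_add2l.
    by apply: leq_trans h2 _; rewrite leq_add2l.
  - have [_ xC xE] := RW x xR.
    have h : loss 0 k <= nbrs_in x R + nbrs_in x (W :|: [set y in C] :|: [set y in E]).
      by apply: degU; rewrite setUC setUCr.
    have h1 := nbrs_inU x (W :|: [set y in C]) [set y in E].
    have h2 := nbrs_inU x W [set y in C].
    have h3 := nbrs_in_seq x C; have h4 := nbrs_in_seq x E.
    have h5 := nbrs_in_card x W.
    have h6 := a2 x C cC sC xR xC HCp.
    have h7 := a2 x E cE sE xR xE HEp.
    rewrite Ek in h.
    have := leq_trans h (leq_add (leqnn _) (leq_trans h1 (leq_add (leq_trans h2 (leq_add h5 h3)) h4))).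
    move: h6 h7 sW; clear; move: (loss p w.+1) => L; lia.
  - have h : minn (2 * (l - 2) + 4) (l - 2 + 6) <= l + 4 by rewrite geq_min; clear -l3; lia.
    move: (minn _ _) h sW lp l3; clear; lia.
  apply: (finish M) => //; first by apply: (packX _ M C cC sC CW pM disE).
  by rewrite sM kw addKn.
(* No packing leaves a short cycle: all cycles of [R] are longer than p + 3, and [last_cycles] is
   applied with [E] empty and s = 0. *)
have [W [_ cW pW]] := pack_support Pp.
rewrite sumn_iota3 in cW.
pose R := ~: W.
have R0 : R != set0.
  apply/eqP => R0; move: Gp; rewrite sumn_iota3 -cW -(setCK W) -/R R0 setC0 cardsT.
  by clear; lia.
have dRW : [disjoint R & W] by rewrite disjoint_subset; apply/subsetP => y; rewrite !inE.
have HRp m : cyc R m -> pack [set: G] (m :: iota 3 p).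
  by move=> cm; apply: pack_sub (subsetT _) (pack_cyc cm pW dRW).
have big m : cyc R m -> p + 3 < m.
  move=> /HRp pm; rewrite ltnNge leq_eqVlt; apply/negP => /orP[/eqP e|mp].
    by rewrite -e pm in n3.
  have := nol m; rewrite mem_iota add0n mp pm /= => /(_ isT).
  by clear -mp; lia.
have degR x : loss 0 k <= nbrs_in x R + (loss 0 p + p).
  rewrite -cW; apply: leq_trans (leq_add (leqnn _) (nbrs_in_card x W)).
  by apply: degU; rewrite setUC setUCr.
case: (posnP w) => [w0|w0].
  (* Here every vertex has at least two neighbours in [R], so the start of a longest path closes a
     cycle. *)
  have [x [q [pq uq qR nq]]] := longest_path_max R0.
  have [/hasP[m _ cm]|/hasPn nom] := boolP (has (cyc R) (iota 0 (size q).+2)).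
    apply: (finish [:: m]) => //=; first exact: HRp.
      by rewrite kw w0 addKn.
    by rewrite big.
  have : count (adj x) q <= 1.
    apply: (count_path_lengths (ML := [::]) pq uq qR) => m mq cm.
    by have := nom m; rewrite mem_iota add0n ltnS mq cm => /(_ isT).
  have := degR x; have := nbrs_in_path nq; rewrite Ek w0 /=; clear; lia.
have eR : R :|: [set y in [::]] = R by apply/setP => y; rewrite !inE orbF.
have [|||||x xR|x xR||M [pM sM uM aM]] :=
  @last_cycles G R [::] p 0 w (loss 0 p + p) (loss 0 p) w0 _ R0; rewrite ?eR //.
- by move=> m mp /big; rewrite ltnNge mp.
- by rewrite -Ek.
- by have := degR x; rewrite Ek; clear; lia.
- by clear; lia.
apply: (finish M) => //; last by rewrite sM kw addKn.
by apply: pack_sub (subsetT _) (pack_cat _ pW dRW); rewrite -eR.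
Qed.

(** * Sharpness *)

Lemma min_degree_le (G : sgraph) (x : G) : min_degree G <= degree x.
Proof.
rewrite /min_degree; have := mem_index_enum x.
elim: (index_enum _) => [//|y s IH]; rewrite inE big_cons geq_min => /orP[/eqP->|/IH->].
  by rewrite leqnn.
by rewrite orbT.
Qed.

Lemma leq_min_degree (G : sgraph) m : m <= #|G| ->
  (forall x : G, m <= degree x) -> m <= min_degree G.
Proof.
move=> mG H; rewrite /min_degree; elim/big_ind: _ => // u v mu mv.
by rewrite leq_min mu.
Qed.

(** Among n + 1 distinct integers at least 2, one is at least n + 2; remove it and induct. *)
Lemma distinct_sum s : uniq s -> all (leq 2) s -> loss 0 (size s) <= sumn s.
Proof.
have [n sn] : exists n, n = size s by exists (size s).
elim: n s sn => [|n IH] s sn us as2; first by rewrite -sn.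
have [/hasP[x xs xn]|/hasPn no] := boolP (has (leq n.+2) s); last first.
  suff : size s <= size (iota 2 n) by rewrite -sn size_iota ltnn.
  apply: uniq_leq_size => // x xs; rewrite mem_iota (allP as2 _ xs) /=.
  by rewrite ltnNge; apply: no.
have sr : n = size (rem x s) by rewrite size_rem // -sn.
have ar : all (leq 2) (rem x s) by apply/allP => y /mem_rem; apply: (allP as2).
have := IH _ sr (rem_uniq x us) ar.
rewrite -sr -sn -[n.+1]addn1 loss_add (perm_sumn (perm_to_rem xs)) /= addn0.
by move: xn; clear; lia.
Qed.

(** * Alternating cycles and complete bipartite graphs *)

Lemma alternating_path (T : Type) (b : pred T) x q :
  path (fun u v => b u != b v) x q ->
  2 * count b q + b x = size q + b (last x q).
Proof.
elim: q x => [|y q IH] x //= /andP[bxy /IH].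
by case: (b x) (b y) bxy => [] [] //= _; lia.
Qed.

Lemma alternating_cycle (T : Type) (b : pred T) c :
  cycle (fun u v => b u != b v) c -> 2 * count b c = size c.
Proof.
case: c => [|x q] //= h; have := alternating_path h.
by rewrite last_rcons size_rcons -cats1 count_cat /=; lia.
Qed.

Lemma bipartite_sym n a :
  symmetric (fun i j : 'I_n => (i < a) != (j < a)).
Proof. by move=> i j; rewrite eq_sym. Qed.

Lemma bipartite_irrefl n a :
  irreflexive (fun i j : 'I_n => (i < a) != (j < a)).
Proof. by move=> i; rewrite eqxx. Qed.

Definition complete_bipartite n a : sgraph :=
  SGraph (@bipartite_sym n a) (@bipartite_irrefl n a).

Lemma card_ltn_ord n a : a <= n -> #|[pred i : 'I_n | i < a]| = a.
Proof.
move=> an; transitivity (\sum_(i < n | i < a) 1); first by rewrite -sum1_card.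
rewrite -(big_mkord (fun i => i < a) (fun _ => 1)) sum1_count.
rewrite /index_iota subn0 -{1}(subnKC an) iotaD count_cat.
have -> : count (fun i => i < a) (iota 0 a) = a.
  rewrite -{3}(size_iota 0 a); apply/eqP; rewrite -all_count.
  by apply/allP => i; rewrite mem_iota.
rewrite (eq_in_count (a2 := pred0)) ?count_pred0 ?addn0 // => i.
by rewrite mem_iota add0n => /andP[h _]; rewrite ltnNge h.
Qed.

Lemma complete_bipartite_degree n a (x : complete_bipartite n a) :
  a <= n -> degree x = if x < a then n - a else a.
Proof.
move=> an; transitivity #|[pred y : 'I_n | (x < a) != (y < a)]|.
  by rewrite /degree cardsE.
case: ifP => xa.
  have := cardC [pred i : 'I_n | i < a]; rewrite card_ord card_ltn_ord // => En.
  rewrite -[X in _ = X - a]En addKn; apply: eq_card => y.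
  by rewrite !inE; case: (y < a).
rewrite -[RHS](card_ltn_ord an); apply: eq_card => y.
by rewrite !inE; case: (y < a).
Qed.

Lemma min_degree_complete_bipartite n a : 2 * a <= n -> 0 < a ->
  min_degree (complete_bipartite n a) = a.
Proof.
move=> an a0; have an' : a < n by lia.
apply/eqP; rewrite eqn_leq; apply/andP; split.
  (* The vertex of index a lies on the large side, hence has degree a. *)
  apply: leq_trans (min_degree_le (Ordinal an' : complete_bipartite n a)) _.
  by rewrite complete_bipartite_degree ?ltnn // ltnW.
apply: leq_min_degree => [|x]; first by rewrite card_ord ltnW.
by rewrite (complete_bipartite_degree x (ltnW an')); case: ifP => // _; clear -an; lia.
Qed.

(* A cycle of K_(a, n - a) of length 2m uses m vertices of the side of size a. *)
Lemma complete_bipartite_no_packing n a k : a <= n -> a < loss 0 k ->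
  ~ has_disjoint_cycles_of_distinct_lengths (complete_bipartite n a) k.
Proof.
move=> an ak [C [cC dC sC]].
pose b := [pred i : 'I_n | i < a].
have H i : 2 * count b (C i) = size (C i).
  by apply: alternating_cycle; case/and3P: (cC i).
pose s := [seq count b (C i) | i <- enum 'I_k].
have us : uniq s.
  rewrite map_inj_uniq ?enum_uniq // => i j e; apply/eqP; apply: contraT => ij.
  by have := sC i j ij; rewrite -(H j) -e H eqxx.
have s2 : all (leq 2) s.
  apply/allP => _ /mapP[i _ ->]; have := H i; have /and3P[] := cC i; lia.
have := distinct_sum us s2; rewrite size_map -cardE card_ord => h.
suff : sumn s <= a by move=> sa; have := leq_trans ak (leq_trans h sa); rewrite ltnn.
rewrite /s sumnE big_map big_enum /= -[leqRHS](card_ltn_ord an) -sum1_card.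
have E i : count b (C i) = \sum_(y : 'I_n | y < a) (y \in C i).
  have /and3P[_ _ uc] := cC i.
  rewrite -size_filter -(card_uniqP (filter_uniq b uc)) -sum1_card.
  rewrite big_mkcond [RHS]big_mkcond; apply: eq_bigr => y _.
  by rewrite mem_filter /=; case: (y < a).
(* Double counting: each of the a vertices of the small side lies on at most one of the disjoint
   cycles. *)
rewrite (eq_bigr _ (fun i _ => E i)) exchange_big /=; apply: leq_sum => y _.
have [/existsP[i yi]|/existsPn no] := boolP [exists i, y \in C i].
  rewrite (bigD1 i) //= yi big1 // => j ji.
  by rewrite (disjointFr (dC i j _) yi) // eq_sym.
by rewrite big1 // => i _; rewrite (negPf (no i)).
Qed.

Lemma half_loss k : k * (k + 3) %/ 2 = loss 0 k.
Proof. by have := lossE 0 k; rewrite muln0 add0n => <-; rewrite mulKn. Qed.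

Theorem theorem2p17 :
  (forall k : nat, 2 <= k -> forall G : sgraph,
     7 * (k ^ 2 %/ 4) <= order_of G ->
     k * (k + 3) %/ 2 <= min_degree G ->
     has_disjoint_cycles_of_distinct_lengths G k)
  /\
  (forall k : nat, 2 <= k ->
     exists N : nat, forall n : nat, N <= n ->
       exists G : sgraph,
         [/\ order_of G = n,
             min_degree G = k * (k + 3) %/ 2 - 1
           & ~ has_disjoint_cycles_of_distinct_lengths G k]).
Proof.
split=> k k2.
  move=> G nG dG; apply: packing_of_degree => // [|x].
    by apply: leq_trans (order_large k2) _; rewrite leq_mul2l.
  rewrite -half_loss; apply: leq_trans dG _; apply: leq_trans (min_degree_le x) _.
  by apply: subset_leq_card; apply/subsetP => y; rewrite !inE.
rewrite half_loss; set a := loss 0 k - 1.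
have l2 : 1 < loss 0 k by case: k k2 {a} => [|[|k]].
have a0 : 0 < a by rewrite subn_gt0.
have al : a < loss 0 k by rewrite /a subn1 prednK // ltnW.
exists (2 * a) => n an; have an' : a <= n by apply: leq_trans an; rewrite leq_pmull.
exists (complete_bipartite n a); split.
- by rewrite /order_of card_ord.
- exact: min_degree_complete_bipartite.
- exact: complete_bipartite_no_packing.
Qed.
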